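(* Let $P\subseteq\{0,1\}^n$ be nonempty and let $L\cap\mathbb{S}^{n+1}_+$ be an SDP relaxation of $P$ satisfying the normalization and arrow constraints. Apply SDD-partial facial reduction to $L\cap\mathbb{S}^{n+1}_+$, where at each step the basis matrix used for the kernel of the exposing matrix has columns with pairwise disjoint supports. If the procedure terminates at the face $F$ (expressed in the original matrix space $\mathbb{S}^{n+1}$), then $$F=\{VRV^T\mid R\in\mathbb{S}^r_+\}$$ for some matrix $V\in\{0,1\}^{(n+1)\times r}$ that has full column rank and whose columns have pairwise disjoint supports.
   Context: Notation. $\mathbb{S}^p$ is the space of real symmetric $p\times p$ matrices with inner product $\langle X,Y\rangle=\operatorname{tr}(XY)$, and $\mathbb{S}^p_+$ is the positive semidefinite cone. Coordinates of $\mathbb{R}^{n+1}$ and $\mathbb{S}^{n+1}$ are indexed by $\{0,1,\dots,n\}$. The support of a vector is the set of indices of its nonzero entries. For a set $S$ of matrices (in particular an affine subspace), $S^\perp=\{Z\mid\langle Z,X\rangle=0\ \forall X\in S\}$. $\operatorname{ri}$ denotes relative interior. A basis matrix of a subspace is a matrix whose columns form a basis of it. SDP relaxation. For an affine subspace $L\subseteq\mathbb{S}^{n+1}$, the set $L\cap\mathbb{S}^{n+1}_+$ is an SDP relaxation of $P$ if $\binom{1}{x}\binom{1}{x}^T\in L$ for every $x\in P$. It satisfies the normalization and arrow constraints if every $Y\in L$ satisfies $Y_{00}=1$ and $Y_{ii}=Y_{0i}$ for $i=1,\dots,n$. SDD cone. $\mathbb{FW}_2^N\subseteq\mathbb{S}^N_+$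 is the set of finite sums $\sum_t g_tg_t^T$ with $g_t\in\mathbb{R}^N$ having at most two nonzero entries. SDD-partial facial reduction. Start with $L_0=L$ and $N_0=n+1$. At step $t$, given an affine subspace $L_t\subseteq\mathbb{S}^{N_t}$: if $L_t^\perp\cap\mathbb{FW}_2^{N_t}=\{0\}$, terminate. Otherwise choose an exposing matrix $W_t\in\operatorname{ri}(L_t^\perp\cap\mathbb{FW}_2^{N_t})$, take a basis matrix $V_t\in\mathbb{R}^{N_t\times N_{t+1}}$ of $\ker(W_t)$ with pairwise disjoint column supports (such a basis exists because $W_t\in\mathbb{FW}_2^{N_t}$), and set $L_{t+1}=\{R\in\mathbb{S}^{N_{t+1}}\mid V_tRV_t^T\in L_t\}$. If the procedure terminates after $T$ steps, the identified face, in the original matrix space, is $F=\{\bar VR\bar V^T\mid R\in\mathbb{S}^{N_T}_+\}$ with $\bar V=V_0V_1\cdots V_{T-1}$ (and $\bar V=I$ if $T=0$). *)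

(* Defs.v *)
From HB Require Import structures.
From mathcomp Require Import all_boot all_order all_algebra.
From mathcomp Require Import boolp classical_sets reals topology normedtype.

Set Implicit Arguments.
Unset Strict Implicit.
Unset Printing Implicit Defensive.

Import Order.TTheory GRing.Theory Num.Theory.
Import numFieldNormedType.Exports.

Local Open Scope classical_set_scope.
Local Open Scope ring_scope.

Section Definitions.
Variable R : realType.

(* The space of symmetric matrices is represented as a set of square matrices;
   "subsets of S^p" are sets of matrices contained in [symmx p]. *)
Definition symmx (p : nat) : set 'M[R]_p := [set X | X^T = X].

Definition mxinner (p : nat) (X Y : 'M[R]_p) : R := \tr (X *m Y).

Definition psd (p : nat) : set 'M[R]_p :=
  [set X | symmx X /\ forall v : 'cV[R]_p, 0 <= (v^T *m X *m v) ord0 ord0].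

(* Possibly empty, as usual for sets cut out by linear equations. *)
Definition affine_subspace (p : nat) (L : set 'M[R]_p) : Prop :=
  L `<=` @symmx p /\
  forall (X Y : 'M[R]_p) (t : R), L X -> L Y -> L (t *: X + (1 - t) *: Y).

(* Orthogonal complement taken inside the symmetric matrices. *)
Definition orthogonal_mx (p : nat) (S : set 'M[R]_p) : set 'M[R]_p :=
  [set Z | symmx Z /\ forall X, S X -> mxinner Z X = 0].

Definition aff_hull (p : nat) (C : set 'M[R]_p) : set 'M[R]_p :=
  [set X | exists (k : nat) (a : 'I_k -> R) (Y : 'I_k -> 'M[R]_p),
    [/\ forall i, C (Y i), \sum_(i < k) a i = 1
      & X = \sum_(i < k) a i *: Y i]].

(* [nbhs] is the product topology on matrices; intersecting with the affine
   hull makes the choice of ambient space (symmetric or all matrices)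
   irrelevant. *)
Definition relint (p : nat) (C : set 'M[R]_p) : set 'M[R]_p :=
  [set X | C X /\ exists2 U : set 'M[R]_p, nbhs X U & U `&` aff_hull C `<=` C].

Definition vsupp (p : nat) (v : 'cV[R]_p) : {set 'I_p} :=
  [set i | v i ord0 != 0]%SET.

Definition FW2 (p : nat) : set 'M[R]_p :=
  [set X | exists2 gs : seq 'cV[R]_p,
    (forall g, g \in gs -> (#|vsupp g| <= 2)%N)
    & X = \sum_(g <- gs) g *m g^T].

Definition disjoint_col_supports (p r : nat) (V : 'M[R]_(p, r)) : Prop :=
  forall j k : 'I_r, j != k ->
    (vsupp (col j V) :&: vsupp (col k V))%SET = finset.set0.

Definition mxker (p : nat) (W : 'M[R]_p) : {vspace 'cV[R]_p} :=
  lker (linfun (mulmx W : 'cV[R]_p -> 'cV[R]_p)).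

Definition basis_matrix (p r : nat) (U : {vspace 'cV[R]_p})
  (V : 'M[R]_(p, r)) : Prop := basis_of U [seq col j V | j <- enum 'I_r].

Definition face_of (p r : nat) (V : 'M[R]_(p, r)) : set 'M[R]_p :=
  [set V *m X *m V^T | X in @psd r].

Definition pullback (p r : nat) (V : 'M[R]_(p, r)) (L : set 'M[R]_p) :
  set 'M[R]_r := [set X | symmx X /\ L (V *m X *m V^T)].

Definition exposing_set (p : nat) (L : set 'M[R]_p) : set 'M[R]_p :=
  orthogonal_mx L `&` @FW2 p.

(* [sddfr_run L Vbar Lt]: from the set [L], finitely many steps of
   SDD-partial facial reduction can lead to the set [Lt] of p x p matrices,
   with [Vbar] the product of the basis matrices chosen so far. *)
Inductive sddfr_run (N : nat) (L : set 'M[R]_N) :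
  forall p : nat, 'M[R]_(N, p) -> set 'M[R]_p -> Prop :=
| sddfr_start : @sddfr_run N L N 1%:M L
| sddfr_step (p r : nat) (Vbar : 'M[R]_(N, p)) (Lt : set 'M[R]_p)
    (W : 'M[R]_p) (V : 'M[R]_(p, r)) :
    @sddfr_run N L p Vbar Lt ->
    exposing_set Lt <> [set 0] ->
    relint (exposing_set Lt) W ->
    basis_matrix (mxker W) V ->
    disjoint_col_supports V ->
    @sddfr_run N L r (Vbar *m V) (pullback V Lt).

Definition sddfr_terminates_at (N : nat) (L F : set 'M[R]_N) : Prop :=
  exists (p : nat) (Vbar : 'M[R]_(N, p)) (Lt : set 'M[R]_p),
    [/\ sddfr_run L Vbar Lt, exposing_set Lt = [set 0] & F = face_of Vbar].

(* The column vector (1; x): entry 0 is 1 and entry i+1 is the i-th entry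
   of x. *)
Definition homogenize (n : nat) (x : 'cV[R]_n) : 'cV[R]_n.+1 :=
  col_mx (1%:M : 'M[R]_1) x.

Definition binary_mx (p r : nat) (V : 'M[R]_(p, r)) : Prop :=
  forall i j, V i j = 0 \/ V i j = 1.

(* [L `&` psd] is an SDP relaxation of [P]. *)
Definition sdp_relaxation (n : nat) (P : set 'cV[R]_n)
  (L : set 'M[R]_n.+1) : Prop :=
  affine_subspace L /\
  forall x, P x -> L (homogenize x *m (homogenize x)^T).

Definition normalization_arrow (n : nat) (L : set 'M[R]_n.+1) : Prop :=
  forall Y, L Y -> Y ord0 ord0 = 1 /\
    forall i : 'I_n, Y (lift ord0 i) (lift ord0 i) = Y ord0 (lift ord0 i).

End Definitions.

(* Main.v *)
(** Along a run, [Vbar] keeps full column rank and disjoint column supports,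
    and [X \in Lt] implies [Vbar X Vbar^T \in L].  At termination the matrix
    unit [E_kk] does not expose [Lt], so some [X \in Lt] has [X_kk <> 0].
    For [i] in the support of column [k] and [l] the column whose support
    contains [0] (it exists because [Y_00 = 1]), the arrow constraint
    [Y_ii = Y_0i] on [Y = Vbar X Vbar^T] reads
    [Vbar_ik X_kk = Vbar_0l X_lk], so [Vbar_ik] does not depend on [i].
    Rescaling the columns of [Vbar] then yields a binary matrix that spans the
    same face. *)
Require Import Defs.
From HB Require Import structures.
From mathcomp Require Import all_boot all_order all_algebra.
From mathcomp Require Import boolp classical_sets reals topology normedtype.

Import GRing.Theory.

Local Open Scope classical_set_scope.
Local Open Scope ring_scope.

Section DisjointSupports.
Set Implicit Arguments.
Unset Strict Implicit.
Context {R : realType}.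

(** Row-wise form: no row has two nonzero entries. This is the form that composes under products. *)
Lemma disjoint_col_supportsP (p r : nat) (V : 'M[R]_(p, r)) :
  disjoint_col_supports V <->
  forall i j k, V i j != 0 -> V i k != 0 -> j = k.
Proof.
split=> [dV i j k Vij Vik | dV j k jk].
  apply/eqP/negPn/negP => /dV /setP /(_ i).
  by rewrite !inE !mxE Vij Vik.
apply/setP => i; rewrite !inE !mxE; apply/negbTE/negP => /andP[Vij Vik].
by move: jk; rewrite (dV i j k Vij Vik) eqxx.
Qed.

Lemma mulmx_entry_neq0 (p q r : nat) (A : 'M[R]_(p, q)) (B : 'M[R]_(q, r)) i j :
  (A *m B) i j != 0 -> exists k, A i k != 0 /\ B k j != 0.
Proof.
move=> ABij; have [k _ /negP] : exists2 k : 'I_q, true & ~ (A i k * B k j == 0).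
  apply: contrapT => nk; move/eqP: ABij; apply; rewrite mxE big1 // => k _.
  by apply/eqP/negPn/negP => Ak; apply: nk; exists k => //; apply/negP.
by rewrite mulf_eq0 negb_or => /andP[]; exists k.
Qed.

(** Row [i] of [A] has at most one nonzero entry, say in column [a], so all nonzero entries in row
    [i] of [A *m B] come from row [a] of [B]. *)
Lemma disjoint_col_supports_mul (p q r : nat) (A : 'M[R]_(p, q))
    (B : 'M[R]_(q, r)) :
  disjoint_col_supports A -> disjoint_col_supports B ->
  disjoint_col_supports (A *m B).
Proof.
move=> /disjoint_col_supportsP dA /disjoint_col_supportsP dB.
apply/disjoint_col_supportsP => i j k.
move=> /mulmx_entry_neq0[a [Aia Baj]] /mulmx_entry_neq0[b [Aib Bbk]].
by apply: (dB a) => //; rewrite (dA i a b).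
Qed.

Lemma disjoint_col_supports1 (p : nat) :
  disjoint_col_supports (1%:M : 'M[R]_p).
Proof.
apply/disjoint_col_supportsP => i j k; rewrite !mxE.
by case: (i =P j) => [<-|]; case: (i =P k) => [<-|]; rewrite ?eqxx.
Qed.

(* Row [i] of [V] has at most one nonzero entry, and so collapses the double
   sum defining the entry of [V X V^T]. *)
Lemma disjoint_conj_entry (p r : nat) (V : 'M[R]_(p, r)) (X : 'M[R]_r) i j k l :
  disjoint_col_supports V -> V i k != 0 -> V j l != 0 ->
  (V *m X *m V^T) i j = V i k * X k l * V j l.
Proof.
move=> /disjoint_col_supportsP dV Vik Vjl.
have V0 a b c : V a b != 0 -> c != b -> V a c = 0.
  by move=> Vab; apply: contra_neq_eq => Vac; apply: (dV a).
rewrite mxE (bigD1 l) //= big1 ?addr0; last first.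
  by move=> c cl; rewrite [V^T _ _]mxE (V0 j l) ?mulr0.
rewrite !mxE (bigD1 k) //= big1 ?addr0 // => c ck.
by rewrite (V0 i k) ?mul0r.
Qed.

Lemma basis_matrix_rank (p r : nat) (U : {vspace 'cV[R]_p})
    (V : 'M[R]_(p, r)) :
  basis_matrix U V -> \rank V = r.
Proof.
move=> /basis_free fV; apply/eqP; rewrite -mxrank_tr.
apply: inj_row_free => u uV0; apply/rowP => j.
pose s := [tuple col j V | j < r].
have /freeP fs : free s by [].
have sj (i : 'I_r) : s`_i = col i V.
  by rewrite -[RHS](tnth_mktuple (fun j => col j V) i) (tnth_nth 0).
rewrite mxE; apply: (fs (u 0)); apply/colP => i.
rewrite summxE [RHS]mxE.
have /rowP/(_ i) := uV0; rewrite !mxE => u0; rewrite -[RHS]u0.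
by apply: eq_bigr => k _; rewrite sj !mxE.
Qed.

Lemma mxrank_mul_full (p q r : nat) (A : 'M[R]_(p, q)) (B : 'M[R]_(q, r)) :
  \rank A = q -> \rank B = r -> \rank (A *m B) = r.
Proof.
move=> rA rB; rewrite -mxrank_tr trmx_mul mxrankMfree ?mxrank_tr //.
by rewrite -row_leq_rank mxrank_tr rA.
Qed.

(** If column [k] vanished, [V^T] would send the [k]-th unit row vector to 0, against
    injectivity. *)
Lemma rank_col_neq0 (p r : nat) (V : 'M[R]_(p, r)) k :
  \rank V = r -> exists i, V i k != 0.
Proof.
move=> rV; apply: contrapT => nV.
have fV : row_free V^T by rewrite -row_leq_rank mxrank_tr rV.
have /(row_free_inj fV)/rowP/(_ k)/eqP :
    delta_mx 0 k *m V^T = (0 : 'rV_r) *m V^T.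
  rewrite mul0mx -rowE; apply/rowP => i; rewrite !mxE.
  by apply/eqP/negPn/negP => Vik; apply: nV; exists i.
by rewrite !mxE !eqxx oner_eq0.
Qed.

Lemma sddfr_run_invariant (N p : nat) (L : set 'M[R]_N) (V : 'M[R]_(N, p))
    (Lt : set 'M[R]_p) :
  sddfr_run L V Lt ->
  [/\ \rank V = p, disjoint_col_supports V
    & forall X, Lt X -> L (V *m X *m V^T)].
Proof.
elim=> {p V Lt} [|p r U Lt W V _ [rU dU LtL] _ _ bV dV]; split.
- exact: mxrank1.
- exact: disjoint_col_supports1.
- by move=> X; rewrite trmx1 mulmx1 mul1mx.
- by apply: mxrank_mul_full rU (basis_matrix_rank bV).
- exact: disjoint_col_supports_mul.
- by move=> X [_ /LtL]; rewrite trmx_mul !mulmxA.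
Qed.

Lemma delta_mx_diag_FW2 (p : nat) (k : 'I_p) : FW2 (delta_mx k k : 'M[R]_p).
Proof.
exists [:: delta_mx k 0] => [g|]; last first.
  by rewrite big_seq1 trmx_delta mul_delta_mx.
rewrite inE => /eqP ->.
apply: (@leq_trans #|[set k]%SET|); last by rewrite cards1.
apply/subset_leq_card/fintype.subsetP => i; rewrite !inE !mxE andbT.
by case: (i == k); rewrite //= eqxx.
Qed.

Lemma exposing_set0_diag_neq0 (p : nat) (L : set 'M[R]_p) (k : 'I_p) :
  exposing_set L = [set 0] -> exists2 X, L X & X k k != 0.
Proof.
move=> L0; apply: contrapT => nL.
have : exposing_set L (delta_mx k k).
  split; last exact: delta_mx_diag_FW2.
  split; first exact: trmx_delta.
  (* Factoring the matrix unit through dimension 1 and cycling the trace leaves the single entry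
     [X k k]. *)
  move=> X LX; rewrite /mxinner -[delta_mx k k](mul_delta_mx (0 : 'I_1)).
  rewrite -mulmxA mxtrace_mulC -rowE /mxtrace big_ord1 -colE !mxE.
  by apply/eqP/negPn/negP => Xkk; apply: nL; exists X.
rewrite L0 => /matrixP/(_ k k)/eqP.
by rewrite !mxE !eqxx oner_eq0.
Qed.

Lemma psd_conj (p r : nat) (A : 'M[R]_(p, r)) (X : 'M[R]_r) :
  psd X -> psd (A *m X *m A^T).
Proof.
move=> [sX pX]; split; first by rewrite /symmx /= !trmx_mul trmxK sX mulmxA.
by move=> v; have := pX (A^T *m v); rewrite trmx_mul trmxK !mulmxA.
Qed.

(** Any right factor can be absorbed into the psd matrix, which gives one inclusion; the other is
    the same inclusion for [V = (V *m D) *m invmx D]. *)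
Lemma face_of_mul_unit (p r : nat) (V : 'M[R]_(p, r)) (D : 'M[R]_r) :
  D \in unitmx -> face_of (V *m D) = face_of V.
Proof.
have sub (r' : nat) (U : 'M[R]_(p, r')) A : face_of (U *m A) `<=` face_of U.
  move=> _ [X pX <-]; exists (A *m X *m A^T); first exact: psd_conj.
  by rewrite trmx_mul !mulmxA.
move=> uD; apply/seteqP; split; first exact: sub.
by rewrite -{1}(mulmxK uD V); apply: sub.
Qed.

Lemma arrow_col_entries (n p : nat) (L : set 'M[R]_n.+1)
    (V : 'M[R]_(n.+1, p)) (X : 'M[R]_p) k :
  normalization_arrow L -> disjoint_col_supports V ->
  L (V *m X *m V^T) -> X k k != 0 ->
  forall i j, V i k != 0 -> V j k != 0 -> V i k = V j k.
Proof.
move=> arrow dV LY Xkk; have [Y00 Yarrow] := arrow _ LY.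
have [l V0l] : exists l, V 0 l != 0.
  have /mulmx_entry_neq0[l [_]] : (V *m X *m V^T) 0 0 != 0.
    by rewrite Y00 oner_eq0.
  by rewrite mxE; exists l.
(* The right-hand side is free of [i]. For [i] nonzero, it comes from the arrow constraint after
   cancelling a factor [V i k]. *)
suff eqc i : V i k != 0 -> V i k = V 0 l * X l k / X k k.
  by move=> i j Vi Vj; rewrite eqc // [RHS]eqc.
case: (unliftP 0 i) => [i' -> | ->] Vik.
  have := Yarrow i'; rewrite (@disjoint_conj_entry _ _ _ _ _ _ k k) //.
  rewrite (@disjoint_conj_entry _ _ _ _ _ _ l k) // => /(mulIf Vik) <-.
  by rewrite mulfK.
(* Here [i] is 0, and row 0 has only one nonzero entry. *)
have -> : l = k by move/disjoint_col_supportsP: dV; apply; eassumption.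
by rewrite mulfK.
Qed.

End DisjointSupports.

Theorem corollary3p2 (R : realType) (n : nat) (P : set 'cV[R]_n)
  (L : set 'M[R]_n.+1) (F : set 'M[R]_n.+1)
  (P_binary : forall x, P x -> binary_mx x)
  (P_nonempty : P !=set0)
  (L_relaxation : sdp_relaxation P L)
  (L_arrow : normalization_arrow L)
  (F_face : sddfr_terminates_at L F) :
  exists (r : nat) (V : 'M[R]_(n.+1, r)),
    [/\ binary_mx V,
        \rank V = r,
        disjoint_col_supports V
      & F = [set V *m X *m V^T | X in @psd R r]].
Proof.
have [p [V [Lt [/sddfr_run_invariant[rV dV LtL] Lt0 ->]]]] := F_face.
have [f Vf] := boolp.choice (fun k => rank_col_neq0 k rV).
(* Column [k] is divided by one of its own nonzero entries; once these are known to be all equal,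
   they all become 1. *)
pose D : 'M[R]_p := diag_mx (\row_k (V (f k) k)^-1).
have uD : D \in unitmx.
  rewrite unitmxE det_diag unitfE; apply/prodf_neq0 => k _.
  by rewrite mxE invr_neq0.
have VD i k : (V *m D) i k = V i k / V (f k) k.
  by rewrite mul_mx_diag !mxE.
exists p, (V *m D); split.
- move=> i k; rewrite VD; have [->|Vik] := eqVneq (V i k) 0.
    by left; rewrite mul0r.
  right; have [X LX Xkk] := exposing_set0_diag_neq0 k Lt0.
  by rewrite (arrow_col_entries L_arrow dV (LtL _ LX) Xkk Vik (Vf k)) divff.
- by apply: mxrank_mul_full rV (mxrank_unit uD).
(* A nonzero entry of [V *m D] sits over a nonzero entry of [V]. *)
- apply/disjoint_col_supportsP => i j k; rewrite !VD !mulf_eq0 !negb_or.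
  move=> /andP[Vij _] /andP[Vik _].
  by move/disjoint_col_supportsP: dV; apply; eassumption.
- by rewrite -[RHS]/(face_of (V *m D)) face_of_mul_unit.
Qed.
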